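(* Let $\mathcal X$ and $\hat{\mathcal X}$ be fixed finite alphabets. There is a quantity $\Delta_n(\ell)$ (depending only on $n$, $\ell$ and the alphabet sizes), defined for positive integers $\ell$ and $n$ with $\ell$ dividing $n$, such that for every fixed $\ell$, $\lim_{n\to\infty}\Delta_n(\ell)=1/\ell$ (the limit being along multiples $n$ of $\ell$), and such that the following holds. Let $\ell$ be a positive integer that divides $n$, let $\hat P^\ell\in\mathcal P_n^\ell$ be an arbitrary $\ell$-th order empirical distribution of sequences in $\mathcal X^n$, and let $\mathcal T_n(\hat P^\ell)\subseteq\mathcal X^n$ be the corresponding type class. Let $d:\mathcal X^n\times\hat{\mathcal X}^n\to[0,\infty)$ be a distortion function that depends on $(x,\hat x)$ only via their first-order joint empirical distribution, $d(x,\hat x)=n\rho(\hat P^1_{x\hat x})$ for some function $\rho$ that does not depend on $n$, and let $D\ge 0$. Then, for every $d$-semifaithful (at distortion level $D$) variable-length block code $(\phi_n,\psi_n)$ of length $n$ with a one-to-one correspondence between the set $\mathcal B_n$ of compressed strings and the reproduction codebook $\mathcal C_n$, and for every $\epsilon>0$, a fraction of at least $1-2n^{-\epsilon}$ of the codewords in the set $\{\phi_n(x):x\in\mathcal T_n(\hat P^\ell)\}$ satisfy $$L(\phi_n(x))\ \ge\ -\log\big(U[\mathcal S(x,D)]\big)-n\Delta_n(\ell)-\epsilon\log n$$ (for every $x\in\mathcal T_n(\hat P^\ell)$ that is encoded to the codeword in question).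
   Context: All logarithms $\log$ are to base 2. $\mathcal X$ (source alphabet) and $\hat{\mathcal X}$ (reproduction alphabet) are finite, with cardinalities $J=|\mathcal X|$ and $K=|\hat{\mathcal X}|$. For $x=(x_1,\dots,x_n)$ write $x_i^j=(x_i,\dots,x_j)$. Empirical distributions. For $\ell$ dividing $n$, the $\ell$-th order empirical distribution of $x\in\mathcal X^n$ is the vector $\hat P_x^\ell=\{\hat P_x^\ell(a^\ell),\,a^\ell\in\mathcal X^\ell\}$, $\hat P_x^\ell(a^\ell)=\frac{\ell}{n}\sum_{i=0}^{n/\ell-1}\mathbf 1\{x_{i\ell+1}^{(i+1)\ell}=a^\ell\}$. $\mathcal P_n^\ell$ is the set of all $\ell$-th order empirical distributions of sequences in $\mathcal X^n$, and for $P^\ell\in\mathcal P_n^\ell$ the type class is $\mathcal T_n(P^\ell)=\{x\in\mathcal X^n:\hat P_x^\ell=P^\ell\}$. The first-order joint empirical distribution of $(x,\hat x)\in\mathcal X^n\times\hat{\mathcal X}^n$ is $\hat P^1_{x\hat x}(a,b)=\frac1n\sum_{i=1}^n\mathbf 1\{x_i=a,\hat x_i=b\}$. Codes. A (variable-length) rate-distortion block code of length $n$ consists of an encoder $\phi_n:\mathcal X^n\to\mathcal B_n$, where $\mathcal B_n\subset\{0,1\}^*$ is a set of variable-length binary strings, and a decoder $\psi_n:\mathcal B_n\to\mathcal C_n\subseteq\hat{\mathcal X}^n$, where $\mathcal C_n$ is the reproduction codebook. The one-to-one correspondence assumption means that $\psi_n:\mathcal B_n\to\mathcal C_n$ is a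 bijection; the code is not required to be prefix-free. The code is $d$-semifaithful (at level $D$) if $d(x,\psi_n(\phi_n(x)))\le nD$ for every $x\in\mathcal X^n$. $L(\phi_n(x))$ is the number of bits of the string $\phi_n(x)$. LZ78 code length. The incremental parsing of $\hat x\in\hat{\mathcal X}^n$ sequentially parses $\hat x$ into phrases such that each new phrase is the shortest string not encountered before as a parsed phrase, with the possible exception of the last phrase, which may be incomplete (example: abbabaabbaaabaa is parsed as a,b,ba,baa,bb,aa,ab,aa). Let $c(\hat x)$ be the number of phrases. $LZ(\hat x)$ denotes the length in bits of the LZ78 binary code of $\hat x$: the $j$-th phrase is encoded by the pair (index in $\{0,\dots,j-1\}$ of the earlier phrase, $0$ being the empty phrase, equal to the phrase with its last symbol removed; last symbol) using $\lceil\log(jK)\rceil$ bits, so that $LZ(\hat x)=\sum_{j=1}^{c(\hat x)}\lceil\log(jK)\rceil$. Universal distribution and spheres. $U(\hat x)=2^{-LZ(\hat x)}\big/\sum_{\hat x'\in\hat{\mathcal X}^n}2^{-LZ(\hat x')}$ for $\hat x\in\hat{\mathcal X}^n$; $\mathcal S(x,D)=\{\hat x\in\hat{\mathcal X}^n: d(x,\hat x)\le nD\}$; $U[\mathcal S(x,D)]=\sum_{\hat x\in\mathcal S(x,D)}U(\hat x)$. *)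

(* Defs.v *)
From HB Require Import structures.
From mathcomp Require Import all_boot all_order all_algebra finmap.
From mathcomp Require Import all_classical all_reals all_analysis.

Set Implicit Arguments.
Unset Strict Implicit.
Unset Printing Implicit Defensive.

Import Order.TTheory GRing.Theory Num.Theory.
Import numFieldNormedType.Exports.

Local Open Scope classical_set_scope.
Local Open Scope ring_scope.

Definition log2 (R : realType) (x : R) : R := ln x / ln 2.

Section Empirical.
Variables (R : realType) (X Xhat : finType).

(* Only meaningful when l divides n: the n/l consecutive blocks are disjoint. *)
Definition emp_dist (n l : nat) (x : n.-tuple X) : {ffun l.-tuple X -> R} :=
  [ffun a : l.-tuple X => l%:R / n%:R *
    \sum_(i < n %/ l) (take l (drop (i * l) x) == a :> seq X)%:R].

Definition emp_dists (n l : nat) : set {ffun l.-tuple X -> R} :=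
  range (@emp_dist n l).

Definition type_class (n l : nat) (P : {ffun l.-tuple X -> R}) :
    {set n.-tuple X} :=
  [set x | emp_dist l x == P]%SET.

Definition joint_emp_dist (n : nat) (x : n.-tuple X) (y : n.-tuple Xhat) :
    {ffun X * Xhat -> R} :=
  [ffun ab : X * Xhat => n%:R^-1 *
    \sum_(i < n) ((tnth x i == ab.1) && (tnth y i == ab.2))%:R].

End Empirical.

Section LZ78.
Variable T : finType.

(* [dict] holds the phrases already parsed, [w] the phrase being read; a
   nonempty [w] left at the end of the input is the incomplete last phrase. *)
Fixpoint lz_parse_rec (dict : seq (seq T)) (w s : seq T) : seq (seq T) :=
  if s is a :: s' then
    let w' := rcons w a in
    if w' \in dict then lz_parse_rec dict w' s'
    else w' :: lz_parse_rec (w' :: dict) [::] s'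
  else if w is [::] then [::] else [:: w].

Definition lz_parse (s : seq T) : seq (seq T) := lz_parse_rec [::] [::] s.

(* [up_log 2 m] is the ceiling of the base-2 logarithm of [m] (for [0 < m]). *)
Definition LZ (s : seq T) : nat :=
  (\sum_(1 <= j < (size (lz_parse s)).+1) up_log 2 (j * #|T|))%N.

End LZ78.

(* abbabaabbaaabaa is parsed as a, b, ba, baa, bb, aa, ab, aa. *)
Example lz_parse_example (a := true) (b := false) :
  lz_parse [:: a; b; b; a; b; a; a; b; b; a; a; a; b; a; a] =
  [:: [:: a]; [:: b]; [:: b; a]; [:: b; a; a]; [:: b; b]; [:: a; a];
      [:: a; b]; [:: a; a]].
Proof. by []. Qed.

Section Universal.
Variables (R : realType) (X Xhat : finType) (n : nat).

Definition Udist (y : n.-tuple Xhat) : R :=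
  2 ^- LZ y / \sum_(z : n.-tuple Xhat) 2 ^- LZ z.

Definition dsphere (d : n.-tuple X -> n.-tuple Xhat -> R) (D : R)
    (x : n.-tuple X) : {set n.-tuple Xhat} :=
  [set y | d x y <= n%:R * D]%SET.

Definition Uprob (A : {set n.-tuple Xhat}) : R := \sum_(y in A) Udist y.

End Universal.

Section Codes.
Variables (R : realType) (X Xhat : finType) (n : nat).

(* The decoder is a total function on binary strings, but only its restriction
   to [strings] matters. No prefix condition is imposed on [strings]. *)
Record rd_code := RDCode {
  strings : set (seq bool);
  codebook : set (n.-tuple Xhat);
  enc : n.-tuple X -> seq bool;
  dec : seq bool -> n.-tuple Xhat;
  enc_strings : forall x, strings (enc x);
  dec_codebook : forall w, strings w -> codebook (dec w)
}.

Definition one_to_one (c : rd_code) : Prop :=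
  set_bij (strings c) (codebook c) (dec c).

Definition semifaithful (d : n.-tuple X -> n.-tuple Xhat -> R) (D : R)
    (c : rd_code) : Prop :=
  forall x, d x (dec c (enc c x)) <= n%:R * D.

Definition codewords (c : rd_code) (A : {set n.-tuple X}) : {fset seq bool} :=
  [fset enc c x | x in A]%fset.

(* Each codeword counts once; it satisfies [Q] when all the members of [A]
   encoded to it do. *)
Definition codeword_fraction (c : rd_code) (A : {set n.-tuple X})
    (Q : n.-tuple X -> bool) : R :=
  #|` [fset w in codewords c A | [forall x in A, (enc c x == w) ==> Q x]]%fset|%:R
  / #|` codewords c A|%:R.

End Codes.

(* Main.v *)
Require Import Defs.
From HB Require Import structures.
From mathcomp Require Import all_boot all_order fingroup perm action.
From mathcomp Require Import all_algebra finmap.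
From mathcomp Require Import all_classical all_reals all_analysis.
From mathcomp Require Import zify ring lra.

Import Order.TTheory GRing.Theory Num.Theory.
Import numFieldNormedType.Exports.

Local Open Scope classical_set_scope.
Local Open Scope ring_scope.

Set Implicit Arguments.
Unset Strict Implicit.
Unset Printing Implicit Defensive.

                                  

(** Write [n = m * l] and fix [x] in the type class. Permuting the [m] blocks of [x] stays in the
    type class, and permuting source and reproduction alike preserves their joint first-order
    distribution, hence the distortion. Each of the [m!] permuted versions of [x] is within
    distortion [n D] of the reproduction of one of the [M] codewords of the class. A fixed
    reproduction [z] can serve [p x] only if [y = p^-1 z] lies in the sphere S about [x], and at
    most [\prod_a N_y(a)!] permutations carry a given [y] to [z], where [N_y(a)] counts the blocks
    of [y] equal to [a]. Double counting gives [m! <= M \sum_(y in S) \prod_a N_y(a)!]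
    ([fact_le_covering]).

    LZ78 enters through an inequality of Ziv type ([LZ_block_entropy]): [LZ y] exceeds the base-2
    logarithm of the multinomial coefficient [m! / \prod_a N_y(a)!] by at most [n] times the
    redundancy. Its proof spells each of the distinct phrases with single letters near its ends and
    aligned blocks in between, and bounds the number of phrases by the entropy of these spellings.
    The extra bit paid per block is the source of the limit 1/l. The Kraft inequality [LZ_kraft]
    gives [2^-LZ(y) <= U(y)], so [M] is at least [2^-(n Delta) / U[S]].

    Finally, there are at most [2^(k+1)] binary strings of length at most [k], so at most a fraction
    [2 n^-eps] of the codewords can be shorter than [log M - eps log n]. No prefix condition is
    involved. *)

(** * Weighted sums over distinct strings *)

Lemma big_tupleS (M : nmodType) (A : finType) (k : nat) (F : seq A -> M) :
  \sum_(t : k.+1.-tuple A) F t = \sum_(a : A) \sum_(t : k.-tuple A) F (a :: t).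
Proof.
rewrite pair_big /= (reindex (fun p : A * k.-tuple A => [tuple of p.1 :: p.2])).
  by [].
exists (fun t : k.+1.-tuple A => (thead t, [tuple of behead t])) => [[a t] _|t _].
  by congr (_, _); apply/val_inj.
by rewrite /= [RHS]tuple_eta; apply/val_inj.
Qed.

Lemma big_tuple0 (M : nmodType) (A : finType) (F : seq A -> M) :
  \sum_(t : 0.-tuple A) F t = F [::].
Proof.
rewrite (big_pred1 [tuple]); first by [].
by move=> t; rewrite /= tuple0; apply/esym/eqP.
Qed.

Lemma ler_sum_uniq_seq (R : numDomainType) (I : eqType) (F : I -> R)
    (s s' : seq I) :
  (forall i, 0 <= F i) -> uniq s -> {subset s <= s'} ->
  \sum_(i <- s) F i <= \sum_(i <- s') F i.
Proof.
move=> F0; elim: s s' => [|x s IHs] s' /=.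
  by move=> _ _; rewrite big_nil sumr_ge0.
move=> /andP[xs us] ss'.
have xs' : x \in s' by apply: ss'; rewrite mem_head.
rewrite (perm_big _ (perm_to_rem xs')) !big_cons lerD2l IHs // => y ys.
have : y \in s' by apply: ss'; rewrite inE ys orbT.
rewrite (perm_mem (perm_to_rem xs')) inE => /orP[/eqP yx|//].
by rewrite -yx ys in xs.
Qed.

Lemma sum_uniq_strings_le (R : numDomainType) (A : finType) (F : seq A -> R)
    (N : nat) (L : seq (seq A)) :
  (forall w, 0 <= F w) -> uniq L -> {in L, forall w, (size w < N)%N} ->
  \sum_(w <- L) F w <= \sum_(k < N) \sum_(t : k.-tuple A) F t.
Proof.
move=> F0 uL sL.
pose LN := flatten [seq [seq val t | t <- enum {: k.-tuple A}] | k <- iota 0 N].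
have -> : \sum_(k < N) \sum_(t : k.-tuple A) F t = \sum_(w <- LN) F w.
  rewrite -(big_mkord xpredT (fun k => \sum_(t : k.-tuple A) F t)) /index_iota.
  rewrite subn0 /LN big_flatten big_map /=.
  by apply: eq_bigr => k _; rewrite big_map big_enum.
apply: ler_sum_uniq_seq => // w wL.
apply/flattenP; exists [seq val t | t <- enum {: (size w).-tuple A}].
  by apply: (map_f (fun k => [seq val t | t <- enum {: k.-tuple A}])); rewrite mem_iota sL.
by apply/mapP; exists (in_tuple w); rewrite ?mem_enum.
Qed.

Lemma sum_tuple_prod (R : comPzSemiRingType) (A : finType) (f : A -> R) (k : nat) :
  \sum_(t : k.-tuple A) \prod_(a <- t) f a = (\sum_a f a) ^+ k.
Proof.
elim: k => [|k IHk].
  by rewrite (big_tuple0 (fun t => \prod_(a <- t) f a)) big_nil.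
rewrite (big_tupleS k (fun t => \prod_(a <- t) f a)) exprS big_distrl /=.
apply: eq_bigr => a _; rewrite -IHk big_distrr /=.
by apply: eq_bigr => t _; rewrite big_cons.
Qed.

(** Grouping all strings by length turns the sum into a geometric series of ratio at most [s]. *)
Lemma sum_uniq_strings_weight_le (R : numFieldType) (A : finType) (f : A -> R)
    (s : R) (L : seq (seq A)) :
  (forall a, 0 <= f a) -> \sum_a f a <= s -> s < 1 -> uniq L ->
  \sum_(w <- L) \prod_(a <- w) f a <= (1 - s)^-1.
Proof.
move=> f0 fs s1 uL.
have s0 : 0 <= s by apply: le_trans fs; exact: sumr_ge0.
pose N := (\max_(w <- L) size w).+1.
have sL : {in L, forall w, (size w < N)%N}.
  by move=> w wL; rewrite ltnS; exact: (@leq_bigmax_seq _ L xpredT (fun w => size w)).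
apply: le_trans (sum_uniq_strings_le (fun w => prodr_ge0 _ (fun a _ => f0 a)) uL sL) _.
under eq_bigr do rewrite sum_tuple_prod.
apply: (@le_trans _ _ (\sum_(k < N) s ^+ k)).
  by apply: ler_sum => k _; rewrite lerXn2r ?nnegrE ?sumr_ge0.
rewrite -[leRHS]mul1r ler_pdivlMr ?subr_gt0 // mulrC -opprB mulNr -subrX1 opprB.
by rewrite gerBl exprn_ge0.
Qed.

Lemma card_strings_le (L : seq (seq bool)) (N : nat) :
  uniq L -> {in L, forall w, (size w < N)%N} -> (size L <= 2 ^ N)%N.
Proof.
move=> uL sL.
have := @sum_uniq_strings_le rat bool (fun=> 1) N L (fun=> ler01) uL sL.
rewrite big_const_seq count_predT iter_addr_0 => h.
rewrite -(ler_nat rat); apply: le_trans h _.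
under eq_bigr do rewrite sumr_const card_tuple card_bool.
rewrite -natr_sum ler_nat.
elim: N {sL} => [|N IH]; first by rewrite big_ord0.
by rewrite big_ord_recr /= expnS mul2n -addnn leq_add2r.
Qed.

                                                                          

(** Gibbs' inequality between the uniform distribution on [L] and the product weights, whose total
    mass is at most [1 / (1 - s)]: many distinct strings cannot all be cheap. This is the only
    counting principle used for LZ phrases, once with letters and once with mixed tokens. *)
Lemma uniq_strings_entropy (R : realType) (A : finType) (f : A -> R) (s : R)
    (L : seq (seq A)) :
  (forall a, 0 <= f a) -> \sum_a f a <= s -> s < 1 -> uniq L ->
  {in L, forall w, {in w, forall a, 0 < f a}} ->
  (size L)%:R * ln (size L)%:R <=
  \sum_(w <- L) \sum_(a <- w) - ln (f a) - (size L)%:R * ln (1 - s).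
Proof.
move=> f0 fs s1 uL fL; set c : R := (size L)%:R.
have [c0|cpos] : c = 0 \/ 0 < c.
  by have := ler0n R (size L); rewrite -/c le_eqVlt => /orP[/eqP <-|]; [left|right].
- have /nilP -> : nilp L by rewrite /nilp -(eqr_nat R) -/c c0.
  by rewrite c0 !mul0r big_nil subr0.
have s0 : 0 < 1 - s by rewrite subr_gt0.
pose F w := \prod_(a <- w) f a.
have FL w : w \in L -> 0 < F w /\ ln (F w) = \sum_(a <- w) ln (f a).
  move=> /fL; rewrite /F; elim: w => [|a w IHw] fw; first by rewrite !big_nil ln1.
  have [|F0 FE] := IHw; first by move=> b bw; rewrite fw// inE bw orbT.
  have fa : 0 < f a by rewrite fw// mem_head.
  by rewrite !big_cons mulr_gt0// lnM ?posrE// FE.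
                                                                            
          
(* Sum [ln t <= t - 1] over [t = F w * (c * (1 - s))]; the values [t] add up to at most [c], the
   number of terms. *)
have step : \sum_(w <- L) ln (F w * (c * (1 - s))) <= 0.
  apply: (@le_trans _ _ (\sum_(w <- L) (F w * (c * (1 - s)) - 1))).
    rewrite big_seq [leRHS]big_seq; apply: ler_sum => w /FL[F0 _].
    have t0 : 0 < F w * (c * (1 - s)) by rewrite !mulr_gt0.
    rewrite -[in leLHS](subrKC 1 (F w * _)); apply: le_ln1Dx.
    by rewrite ltrBrDl subrr.
  rewrite sumrB -mulr_suml big_const_seq count_predT iter_addr_0 subr_le0 -/c.
  have := sum_uniq_strings_weight_le f0 fs s1 uL.
  rewrite -div1r ler_pdivlMr // => h.
  rewrite mulrCA -[leRHS]mulr1 ler_pM2l //.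
rewrite -subr_ge0 -oppr_le0; apply: le_trans step; rewrite le_eqVlt.
apply/orP; left; apply/eqP.
rewrite [RHS]big_seq.
rewrite [RHS](eq_bigr (fun w => - (\sum_(a <- w) - ln (f a)) + (ln c + ln (1 - s)))); last first.
  move=> w /FL[F0 FE]; rewrite lnM ?posrE ?mulr_gt0// lnM ?posrE// FE.
  by rewrite sumrN opprK.
rewrite -big_seq big_split /= sumrN big_const_seq count_predT iter_addr_0.
rewrite -mulr_natl -/c; ring.
Qed.

(** * Factorial estimates and the count of relabelling permutations *)

Lemma ln_fact_ge (R : realType) (k : nat) :
  k%:R * ln k%:R - k%:R <= ln (k`!)%:R :> R.
Proof.
elim: k => [|k IHk]; first by rewrite mul0r subr0 fact0 ln1.
rewrite factS natrM lnM ?posrE ?ltr0n ?fact_gt0 //.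
have k1 : 0 < k.+1%:R :> R by rewrite ltr0n.
case: k IHk k1 => [|k] IHk k1; first by rewrite fact0 !ln1; lra.
have k0 : 0 < k.+1%:R :> R by rewrite ltr0n.
have : ln (1 + k.+1%:R^-1) <= k.+1%:R^-1 :> R.
  by apply: le_ln1Dx; rewrite (lt_trans (@ltrN10 R)) // invr_gt0.
have -> : 1 + k.+1%:R^-1 = k.+2%:R / k.+1%:R :> R.
  by rewrite -[k.+2%:R]natr1 mulrDl mulfV ?gt_eqF // div1r.
rewrite ln_div ?posrE // -(ler_pM2l k0) mulfV ?gt_eqF // => h.
have e : k.+2%:R = k.+1%:R + 1 :> R by rewrite natr1.
move: h IHk; set y := ln _`!%:R; set z := ln k.+2%:R; rewrite e; set x := k.+1%:R.
lra.
Qed.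

Lemma ln_fact_le (R : realType) (k : nat) :
  ln (k`!)%:R <= k%:R * ln k%:R - k%:R + 1 + ln k%:R :> R.
Proof.
elim: k => [|k IHk]; first by rewrite mul0r fact0 ln1 ln0 //; lra.
rewrite factS natrM lnM ?posrE ?ltr0n ?fact_gt0 //.
case: k IHk => [|k] IHk; first by rewrite fact0 !ln1; lra.
have k1 : 0 < k.+2%:R :> R by rewrite ltr0n.
have k0 : 0 < k.+1%:R :> R by rewrite ltr0n.
have : ln (1 - k.+2%:R^-1) <= - k.+2%:R^-1 :> R.
  apply: le_ln1Dx; rewrite ltrN2 invf_lt1 // ltr1n //.
have -> : 1 - k.+2%:R^-1 = k.+1%:R / k.+2%:R :> R.
  by rewrite -[k.+1%:R](addrK 1) natr1 mulrBl mulfV ?gt_eqF // div1r.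
rewrite ln_div ?posrE // -(ler_pM2l k1) mulrN mulfV ?gt_eqF // => h.
have e : k.+2%:R = k.+1%:R + 1 :> R by rewrite natr1.
move: h IHk; set y := ln _; set z := ln k.+2%:R; rewrite e; set x := k.+1%:R.
lra.
Qed.

(** The permutations in question form either the empty set or a coset of the stabilizer of [b], and
    that stabilizer embeds in the product of the symmetric groups of the fibres of [b] by
    restriction. *)
Lemma card_perm_relabel (I B : finType) (b b' : I -> B) :
  (#|[set p : {perm I} | [forall i, b (p i) == b' i]]%SET| <=
   \prod_(a : B) (#|[set i | b i == a]%SET|)`!)%N.
Proof.
set S := [set p | _]%SET; pose C a := [set i | b i == a]%SET.
have [->|[p0]] := set_0Vmem S; first by rewrite cards0.
rewrite inE => /forallP p0P.
pose G := [set p : {perm I} | [forall i, b (p i) == b i]]%SET.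
have SG : (#|S| <= #|G|)%N.
  rewrite -(card_imset S (mulgI (p0^-1)%g)); apply/subset_leq_card/fintype.subsetP => q.
  move=> /imsetP[p]; rewrite inE => /forallP pP ->; rewrite inE.
  apply/forallP => i; rewrite permM (eqP (pP _)) -(eqP (p0P _)) permKV //.
apply: leq_trans SG _.
have GN (a : B) (p : {perm I}) : p \in G -> p \in ('N(C a | 'P))%g.
  rewrite inE => /forallP pP; rewrite inE.
  apply/andP; split; first by rewrite inE.
  by rewrite inE; apply/fintype.subsetP => i; rewrite !inE /= /aperm (eqP (pP _)).
pose h (p : {perm I}) : {ffun B -> {perm I}} := [ffun a => restr_perm (C a) p].
have hI : {in G &, injective h}.
  move=> p q pG qG /ffunP hpq; apply/permP => i.
  have := hpq (b i); rewrite !ffunE => /permP/(_ i).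
  by rewrite !restr_permE ?GN // /C inE.
rewrite -(card_in_imset hI).
have -> : \prod_(a : B) (#|C a|)`! = #|family (fun a => perm_on (C a) : pred {perm I})|.
  rewrite card_family foldrE big_map big_enum /=.
  by apply: eq_bigr => a _; rewrite -card_perm.
apply/subset_leq_card/fintype.subsetP => _ /imsetP[p pG ->].
by apply/familyP => a; rewrite ffunE; exact: restr_perm_on.
Qed.

                                              

(** * Incremental parsing *)

Lemma size_lz_parse_rec (T : finType) (dict : seq (seq T)) (w s : seq T) :
  (size (lz_parse_rec dict w s) <= size s + (w != [::]))%N.
Proof.
elim: s dict w => [|a s IHs] dict w /=; first by case: w.
case: ifP => _; first by apply: leq_trans (IHs _ _) _; case: eqP; case: eqP => _ _ /=; lia.
by rewrite /= addSn ltnS; apply: leq_trans (IHs _ _) _; rewrite eqxx addn0 leq_addr.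
Qed.

Lemma size_lz_parse (T : finType) (s : seq T) : (size (lz_parse s) <= size s)%N.
Proof. by have := size_lz_parse_rec [::] [::] s; rewrite addn0. Qed.

Lemma flatten_lz_parse_rec (T : finType) (dict : seq (seq T)) (w s : seq T) :
  flatten (lz_parse_rec dict w s) = w ++ s.
Proof.
elim: s dict w => [|a s IHs] dict w /=.
  by case: w => [//|b w]; rewrite /= !cats0.
by case: ifP => _ /=; rewrite IHs // cat_rcons.
Qed.

Lemma flatten_lz_parse (T : finType) (s : seq T) : flatten (lz_parse s) = s.
Proof. exact: flatten_lz_parse_rec. Qed.

(** Every completed phrase is new when it is emitted; [L'] holds the final incomplete phrase, the
    only one that may repeat an earlier one. *)
Lemma uniq_lz_parse_rec (T : finType) (dict : seq (seq T)) (w s : seq T) :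
  exists L L', [/\ lz_parse_rec dict w s = L ++ L', uniq L,
    {in L, forall v, v \notin dict} & (size L' <= 1)%N].
Proof.
elim: s dict w => [|a s IHs] dict w /=; first by exists [::]; case: w; eexists.
case: ifPn => [_|wa]; first exact: IHs.
have [L [L' [-> uL Ldict sL']]] := IHs (rcons w a :: dict) [::].
exists (rcons w a :: L), L'; split => //=.
  by rewrite uL andbT; apply/negP => /Ldict; rewrite mem_head.
move=> v; rewrite inE => /orP[/eqP -> //|/Ldict].
by rewrite inE negb_or => /andP[].
Qed.

Lemma uniq_lz_parse (T : finType) (s : seq T) :
  exists L L', [/\ lz_parse s = L ++ L', uniq L & (size L' <= 1)%N].
Proof.
by have [L [L' [? ? _ ?]]] := uniq_lz_parse_rec [::] [::] s; exists L, L'.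
Qed.

(** * Kraft inequality for LZ78 code lengths *)

(** Each entry properly extending [w] does so through exactly one next letter; the successor
    accounts for [w] itself. *)
Lemma sum_count_prefix_rcons (T : finType) (D : seq (seq T)) (w : seq T) :
  w \in D ->
  ((\sum_(a : T) count (prefix (rcons w a)) D).+1 <= count (prefix w) D)%N.
Proof.
move=> wD; rewrite -addn1.
apply: (@leq_trans (\sum_(a : T) count (prefix (rcons w a)) D + count_mem w D)).
  by rewrite leq_add2l -has_count has_pred1.
have countE p : count p D = (\sum_(d <- D) p d)%N.
  by rewrite -sum1_count big_mkcond; apply: eq_bigr => d _; case: (p d).
rewrite (eq_bigr _ (fun a _ => countE (prefix (rcons w a)))) !countE.
rewrite exchange_big -big_split /=; apply: leq_sum => d _.
have [/existsP[a /prefixP[t ->]]|no] := boolP [exists a, prefix (rcons w a) d].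
  rewrite cat_rcons.
  have -> : (w ++ a :: t == w) = false.
    by apply/eqP => /(congr1 size); rewrite size_cat /=; lia.
  rewrite addn0 prefix_prefix (bigD1 a) //= big1 ?addn0 ?leq_b1 //.
  move=> b /negPf ba; apply/eqP; rewrite eqb0; apply: contraFN ba.
  by rewrite -cats1 prefix_catr //= eqxx /= => /andP[].
rewrite big1 ?add0n; last first.
  by move=> a _; move/existsPn : no => /(_ a) /negPf ->.
by case: eqP => [->|//]; rewrite prefix_refl.
Qed.

Section LZKraft.
Variables (R : realType) (T : finType).
Hypothesis T_gt0 : (0 < #|T|)%N.

                                                       
Let bits (j N : nat) : nat := \sum_(j <= i < j + N) up_log 2 (i.+1 * #|T|).

(** Kraft mass of all length-[k] continuations of the parser state [(dict, w)]. *)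
Let weight (k : nat) (dict : seq (seq T)) (w : seq T) : R :=
  \sum_(t : k.-tuple T) 2 ^- bits (size dict) (size (lz_parse_rec dict w t)).

Let weight0_le1 (k : nat) (dict : seq (seq T)) :
  ((0 < k)%N -> weight k dict [::] <=
    (count (prefix [::]) ([::] :: dict) * #|T|)%:R *
      2 ^- up_log 2 ((size dict).+1 * #|T|)) ->
  weight k dict [::] <= 1.
Proof.
case: k => [_|k /(_ isT) /le_trans]; last apply.
  rewrite /weight (big_tuple0 (fun t => 2 ^- bits _ (size (lz_parse_rec _ _ t)))).
  by rewrite /bits /= addn0 big_geq // expr0 invr1.
rewrite ler_pdivrMr ?exprn_gt0 // mul1r -natrX ler_nat.
have -> : count (prefix [::]) ([::] :: dict) = (size dict).+1.
  by rewrite /= add1n; congr _.+1; rewrite -count_predT; apply: eq_count => -[].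
exact: up_logP.
Qed.

                                                                               
                                                                      
(** The next phrase is coded by a dictionary entry (or the empty phrase) and a letter. From state
    [w] only the entries extending [w] can still be used, so the bound counts those pairs times the
    mass of one codeword. The excluded state, [k = 0] with [w] empty, has nothing left to code and
    mass 1. *)
Let weight_le (k : nat) (dict : seq (seq T)) (w : seq T) :
  w \in [::] :: dict -> (0 < k)%N || (w != [::]) ->
  weight k dict w <= (count (prefix w) ([::] :: dict) * #|T|)%:R *
    2 ^- up_log 2 ((size dict).+1 * #|T|).
Proof.
elim: k dict w => [|k IHk] dict w wD kw.
  rewrite /weight (big_tuple0 (fun t => 2 ^- bits _ (size (lz_parse_rec _ _ t)))).
  case: w wD kw => [//|b w] wD _.
  rewrite /= /bits addn1 big_nat1 ler_peMl ?invr_ge0 ?exprn_ge0 //.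
  rewrite ler1n muln_gt0 T_gt0 andbT.
  have : has (prefix (b :: w)) ([::] :: dict).
    by apply/hasP; exists (b :: w) => //; exact: prefix_refl.
  by rewrite has_count.
rewrite /weight.
rewrite (big_tupleS k (fun t => 2 ^- bits _ (size (lz_parse_rec _ _ t)))) /=.
set u := up_log 2 _.
apply: (@le_trans _ _ (\sum_a
   (count (prefix (rcons w a)) ([::] :: dict) * #|T| + 1)%:R * 2 ^- u)).
  apply: ler_sum => a _; case: (boolP (rcons w a \in dict)) => wa.
    apply: le_trans (IHk dict (rcons w a) _ _) _.
    - by rewrite inE wa orbT.
    - by case: (w) => //=; rewrite orbT.
    - by rewrite ler_wpM2r ?invr_ge0 ?exprn_ge0 // ler_nat leq_addr.
  apply: (@le_trans _ _ (1 * 2 ^- u)); last first.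
    by rewrite ler_wpM2r ?invr_ge0 ?exprn_ge0 // ler1n addn1.
  under eq_bigr.
    move=> t _.
    rewrite [size _]/= /bits addnS -addSn big_ltn ?ltnS ?leq_addr //.
    rewrite -/u exprD invfM mulrC.
    over.
  rewrite -mulr_suml ler_wpM2r ?invr_ge0 ?exprn_ge0 //.
  (* A phrase has just been completed: the remaining mass is at most 1, because with [w] empty all
     pairs are available and there are at most [2 ^ up_log] of them. *)
  apply: (@weight0_le1 k (rcons w a :: dict)) => k0.
  by apply: IHk; rewrite ?mem_head // k0.
rewrite -mulr_suml ler_wpM2r ?invr_ge0 ?exprn_ge0 // -natr_sum ler_nat.
have -> : (\sum_a (count (prefix (rcons w a)) ([::] :: dict) * #|T| + 1) =
    (\sum_a count (prefix (rcons w a)) ([::] :: dict)).+1 * #|T|)%N.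
  by rewrite big_split -big_distrl sum1_card mulSnr.
exact: leq_mul (sum_count_prefix_rcons wD) (leqnn _).
Qed.

Lemma LZ_kraft (n : nat) : \sum_(z : n.-tuple T) 2 ^- LZ z <= 1 :> R.
Proof.
have -> : \sum_(z : n.-tuple T) 2 ^- LZ z = weight n [::] [::].
  by apply: eq_bigr => z _; rewrite /LZ big_add1.
apply: weight0_le1 => n0; apply: weight_le; first exact: mem_head.
by rewrite n0.
Qed.

End LZKraft.

                          

(** * Blocks, and token spellings of the phrases *)

Lemma block_index_lt (m l : nat) (i : 'I_m) (j : 'I_l) : (i * l + j < m * l)%N.
Proof.
apply: (@leq_trans (i.+1 * l)); first by rewrite mulSn addnC ltn_add2r.
by rewrite leq_mul2r ltn_ord orbT.
Qed.

Definition block_index (m l : nat) (i : 'I_m) (j : 'I_l) : 'I_(m * l) :=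
  Ordinal (block_index_lt i j).

Definition block (A : Type) (m l : nat) (x : (m * l).-tuple A) (i : 'I_m) :
    l.-tuple A :=
  [tuple tnth x (block_index i j) | j < l].

Lemma val_block (A : Type) (m l : nat) (x : (m * l).-tuple A) (i : 'I_m) :
  block x i = take l (drop (i * l) x) :> seq A.
Proof.
have sz : size (take l (drop (i * l) x)) = l.
  rewrite size_takel // size_drop size_tuple -mulnBl.
  by rewrite leq_pmull // subn_gt0.
case: l x sz => [|l] x sz; first by rewrite take0 tuple0.
have x0 := tnth x (block_index i ord0).
apply: (@eq_from_nth _ x0); first by rewrite sz size_tuple.
rewrite size_tuple => j jl; rewrite nth_take // nth_drop.
by rewrite -(tnth_nth x0 _ (Ordinal jl)) tnth_mktuple (tnth_nth x0).
Qed.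

Definition multiplicity (A : finType) (m l : nat) (x : (m * l).-tuple A)
    (a : l.-tuple A) : nat :=
  #|[set i | block x i == a]%SET|.

Section Tokens.
Variables (R : realType) (T : finType) (m l : nat) (y : (m * l).-tuple T).
Hypotheses (T_gt0 : (0 < #|T|)%N) (m_gt0 : (0 < m)%N) (l_gt0 : (0 < l)%N).

Let token : finType := (T + l.-tuple T)%type.

Let detok (t : token) : seq T :=
  match t with inl a => [:: a] | inr b => b end.

Let decode (s : seq token) : seq T := flatten (map detok s).

Let decode_cat (s s' : seq token) : decode (s ++ s') = decode s ++ decode s'.
Proof. by rewrite /decode map_cat flatten_cat. Qed.

Let decode_letters (s : seq T) : decode (map inl s) = s.
Proof. by elim: s => //= a s IHs; rewrite /decode /= -/(decode _) IHs. Qed.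

(** Letters share mass 1/4 uniformly; blocks share mass 1/2 according to their empirical frequency
    in [y]. The total 3/4 stays below 1, and the factor 1/2 costs one bit per block. *)
Let f (t : token) : R :=
  match t with
  | inl _ => (4 * #|T|%:R)^-1
  | inr b => (multiplicity y b)%:R / (2 * m%:R)
  end.

Let f_ge0 (t : token) : 0 <= f t.
Proof. by case: t => b; rewrite ?invr_ge0 ?divr_ge0 // mulr_ge0. Qed.

Let sum_multiplicity : (\sum_a multiplicity y a)%N = m.
Proof.
rewrite -[RHS]card_ord -sum1_card (partition_big (block y) xpredT) //=.
by apply: eq_bigr => b _; rewrite sum1dep_card.
Qed.

Let sum_f : \sum_t f t <= 3 / 4.
Proof.
have K0 : #|T|%:R != 0 :> R by rewrite pnatr_eq0 -lt0n.
have m0 : m%:R != 0 :> R by rewrite pnatr_eq0 -lt0n.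
rewrite big_sumType /= sumr_const -mulr_suml -natr_sum sum_multiplicity.
rewrite -mulr_natl le_eqVlt; apply/orP; left; apply/eqP; field.
by rewrite K0 m0.
Qed.

(** Out-of-range indices default to block 0, so that block costs can be summed over natural
    numbers. *)
Let ord_of (i : nat) : 'I_m := insubd (Ordinal m_gt0) i.

Let block_cost (i : nat) : R := - ln (f (inr (block y (ord_of i)))).

Let f_block_gt0 (i : nat) : 0 < f (inr (block y (ord_of i))).
Proof.
rewrite /f divr_gt0 ?mulr_gt0 ?ltr0n // /multiplicity card_gt0.
by apply/set0Pn; exists (ord_of i); rewrite inE.
Qed.

Let block_cost_ge0 (i : nat) : 0 <= block_cost i.
Proof.
rewrite oppr_ge0 ln_le0 // ler_pdivrMr ?mul1r ?mulr_gt0 ?ltr0n //.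
apply: (@le_trans _ _ m%:R); last by rewrite ler_peMl // ler1n.
by rewrite ler_nat (leq_trans (max_card _)) // card_ord.
Qed.

(** Cumulative block cost: its increments over consecutive phrases telescope. *)
Let Phi (p : nat) : R := \sum_(0 <= i < p) block_cost i.

Let Phi_le (p q : nat) : (p <= q)%N -> Phi p <= Phi q.
Proof.
by move=> pq; rewrite /Phi (big_cat_nat _ pq) //= lerDl sumr_ge0.
Qed.

Let slice (p e : nat) : seq T := drop p (take e y).

Let slice_cat (p q e : nat) :
  (p <= q)%N -> (q <= e)%N -> (e <= m * l)%N ->
  slice p q ++ slice q e = slice p e.
Proof.
move=> pq qe en.
rewrite /slice -[in RHS](cat_take_drop q (take e y)) take_takel // drop_cat.
rewrite size_takel ?size_tuple ?(leq_trans qe) //.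
case: ltnP => // qp; have -> : p = q by apply/eqP; rewrite eqn_leq pq.
by rewrite subnn drop0 drop_oversize // size_take_min geq_minl.
Qed.

Let size_slice (p e : nat) : (e <= m * l)%N -> size (slice p e) = (e - p)%N.
Proof. by move=> en; rewrite size_drop size_takel ?size_tuple. Qed.

Let slice_block (i : nat) : (i < m)%N ->
  slice (i * l) (i.+1 * l) = block y (ord_of i).
Proof.
move=> im; rewrite val_block /ord_of val_insubd im.
by rewrite /slice take_drop mulSn.
Qed.

Let block_tokens (i j : nat) : seq token :=
  [seq inr (block y (ord_of k)) | k <- index_iota i j].

Let decode_blocks (i j : nat) : (i <= j)%N -> (j <= m)%N ->
  decode (block_tokens i j) = slice (i * l) (j * l).
Proof.
move=> ij; rewrite -(subnKC ij); elim: (j - i)%N => [|k IHk] jm.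
  rewrite addn0 /block_tokens /index_iota subnn /slice drop_oversize //.
  by rewrite size_take_min geq_minl.
rewrite addnS in jm *.
rewrite /block_tokens /index_iota subSn ?leq_addr // -addn1 iotaD map_cat.
rewrite decode_cat [X in _ ++ X]/decode /= cats0 IHk 1?ltnW //.
rewrite subnKC ?leq_addr // -slice_block // slice_cat //.
- by rewrite leq_mul2r leq_addr orbT.
- by rewrite leq_mul2r leqnSn orbT.
- by rewrite leq_mul2r jm orbT.
Qed.

Let letter_cost (s : seq T) :
  \sum_(t <- map inl s) - ln (f t) = (size s)%:R * ln (4 * #|T|%:R) :> R.
Proof.
rewrite big_map (eq_bigr (fun=> ln (4 * #|T|%:R))); last first.
  by move=> a _; rewrite /f lnV ?posrE ?mulr_gt0 ?ltr0n // opprK.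
by rewrite big_const_seq count_predT iter_addr_0 [RHS]mulr_natl.
Qed.

Let ln4K_ge0 : 0 <= ln (4 * #|T|%:R) :> R.
Proof. by rewrite ln_ge0 // -natrM ler1n muln_gt0. Qed.

                                                                             
                                     
(** Spell the factor with whole aligned blocks wherever they fit and with letters at its two ragged
    ends, each shorter than [l]. *)
Let tokenize (p e : nat) : (p <= e)%N -> (e <= m * l)%N ->
  exists s : seq token, [/\ decode s = slice p e,
    {in s, forall t, 0 < f t} &
    \sum_(t <- s) - ln (f t) <=
      (2 * l)%:R * ln (4 * #|T|%:R) + (Phi (e %/ l) - Phi (p %/ l))].
Proof.
move=> pe en.
have fl (s : seq T) : {in map inl s : seq token, forall t, 0 < f t}.
  by move=> _ /mapP[a _ ->]; rewrite invr_gt0 mulr_gt0 ?ltr0n.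
(* The first block boundary at or after [p], and the last one at or before [e]. *)
pose i := ((p + l.-1) %/ l)%N; pose j := (e %/ l)%N.
have pi : (p <= i * l)%N.
  have := divn_eq (p + l.-1) l; have := ltn_pmod (p + l.-1) l_gt0.
  by rewrite -/i => ? ?; lia.
have il : (i * l <= p + l.-1)%N by exact: leq_trunc_div.
have je : (j * l <= e)%N by exact: leq_trunc_div.
have ej : (e < j * l + l)%N by rewrite {1}(divn_eq e l) ltn_add2l ltn_pmod.
have pli : (p %/ l <= i)%N by rewrite leq_div2r // leq_addr.
have jm : (j <= m)%N by rewrite -(leq_pmul2r l_gt0) (leq_trans je).
(* If [j < i], the factor contains no block boundary and is shorter than [l]: letters suffice. *)
have [ij|ji] := leqP i j; last first.
  exists (map inl (slice p e)); rewrite decode_letters; split=> //.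
  rewrite letter_cost size_slice // ler_wpDr // ?subr_ge0 ?Phi_le ?leq_div2r //.
  rewrite ler_wpM2r // ler_nat.
  have : (j.+1 * l <= i * l)%N by rewrite leq_mul2r ji orbT.
  by rewrite mulSn => ?; lia.
have ijl : (i * l <= j * l)%N by rewrite leq_mul2r ij orbT.
exists (map inl (slice p (i * l)) ++ block_tokens i j ++ map inl (slice (j * l) e)).
split.
- rewrite !decode_cat !decode_letters decode_blocks // slice_cat //.
  by rewrite slice_cat // (leq_trans ijl).
- move=> t; rewrite !mem_cat => /orP[/fl //|/orP[|/fl //]].
  by move=> /mapP[k _ ->]; exact: f_block_gt0.
rewrite !big_cat /= !letter_cost !size_slice //; last first.
  by rewrite (leq_trans ijl) // (leq_trans je).
rewrite addrCA addrC -mulrDl -natrD; apply: lerD.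
  by rewrite ler_wpM2r // ler_nat; lia.
rewrite big_map -/(block_cost _).
have -> : Phi (e %/ l) = Phi i + \sum_(k <- index_iota i j) block_cost k.
  by rewrite /Phi -/j (big_cat_nat _ ij).
by rewrite addrAC lerDr subr_ge0 Phi_le.
Qed.

Let tokenize_factors (ws : seq (seq T)) (p : nat) :
  (p + size (flatten ws) <= m * l)%N ->
  flatten ws = slice p (p + size (flatten ws)) ->
  exists ss : seq (seq token), [/\ map decode ss = ws,
    {in ss, forall s, {in s, forall t, 0 < f t}} &
    \sum_(s <- ss) \sum_(t <- s) - ln (f t) <=
      (size ws)%:R * ((2 * l)%:R * ln (4 * #|T|%:R)) +
      (Phi ((p + size (flatten ws)) %/ l) - Phi (p %/ l))].
Proof.
elim: ws p => [|w ws IHws] p /=.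
  by exists [::]; split=> //; rewrite big_nil mul0r addn0 subrr addr0.
rewrite size_cat addnA => en E.
have le1 : (p <= p + size w)%N by rewrite leq_addr.
have le2 : (p + size w <= p + size w + size (flatten ws))%N by rewrite leq_addr.
move: E; rewrite -(slice_cat le1 le2 en) => /eqP; rewrite eqseq_cat; last first.
  by rewrite size_slice ?(leq_trans le2) // addKn.
move=> /andP[/eqP wE /eqP wsE].
have [s [sE sf sc]] := tokenize le1 (leq_trans le2 en).
have [ss [ssE ssf ssc]] := IHws _ en wsE.
exists (s :: ss); split=> [|t|].
- by rewrite /= sE ssE -wE.
- by rewrite inE => /orP[/eqP ->|/ssf].
rewrite big_cons; apply: le_trans (lerD sc ssc) _.
rewrite -[(size ws).+1%:R]natr1 mulrDl mul1r le_eqVlt; apply/orP; left.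
by apply/eqP; ring.
Qed.

(** Distinct phrases have distinct spellings, since [decode] recovers the phrase. Hence
    [uniq_strings_entropy] applies with [s = 3/4], and the block costs of all phrases together are
    at most those of all [m] blocks. *)
Lemma distinct_factors_entropy (L L' : seq (seq T)) :
  val y = flatten (L ++ L') -> uniq L ->
  (size L)%:R * ln (size L)%:R <=
    m%:R * ln 2 + \sum_(i < m) - ln ((multiplicity y (block y i))%:R / m%:R)
    + (size L)%:R * ((2 * l)%:R * ln (4 * #|T|%:R) + ln 4) :> R.
Proof.
move=> yE uL.
have sL : (size (flatten L) <= m * l)%N.
  by rewrite -(size_tuple y) yE flatten_cat size_cat leq_addr.
have [] := @tokenize_factors L 0; rewrite ?add0n //.
  by rewrite /slice drop0 yE flatten_cat take_size_cat.
move=> ss [ssE ssf ssc].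
have uss : uniq ss by apply: (@map_uniq _ _ decode); rewrite ssE.
have sss : size ss = size L by rewrite -ssE size_map.
have := uniq_strings_entropy f_ge0 sum_f _ uss ssf.
rewrite sss => /(_ _)/le_trans; apply; first lra.
have -> : 1 - 3 / 4 = 4^-1 :> R by field.
rewrite lnV ?posrE // mulrN opprK [X in _ <= _ + X]mulrDr [leRHS]addrA lerD2r.
apply: le_trans ssc _; rewrite [leLHS]addrC; apply: lerD; last by [].
rewrite div0n [Phi 0]big_geq // subr0.
have sLm : (size (flatten L) %/ l <= m)%N by rewrite -(mulnK m l_gt0) leq_div2r.
apply: le_trans (Phi_le sLm) _.
rewrite /Phi big_mkord.
have -> : m%:R * ln 2 = \sum_(i < m) ln 2 :> R.
  by rewrite sumr_const card_ord mulr_natl.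
rewrite -big_split /= le_eqVlt; apply/orP; left; apply/eqP; apply: eq_bigr => i _.
have iE : ord_of i = i by apply: val_inj; rewrite val_insubd ltn_ord.
have := f_block_gt0 i; rewrite /block_cost iE /f => fi.
have m0 : m%:R != 0 :> R by rewrite pnatr_eq0 -lt0n.
have -> : (multiplicity y (block y i))%:R / m%:R =
   2 * ((multiplicity y (block y i))%:R / (2 * m%:R)) :> R by field.
by rewrite [ln (2 * (_ / _))]lnM ?posrE //; ring.
Qed.

End Tokens.

                   

(** * LZ78 length against block entropy *)

Lemma up_log2_le (R : realType) (x : nat) : (0 < x)%N ->
  (up_log 2 x)%:R * ln 2 <= ln (2 * x%:R) :> R.
Proof.
move=> x0; rewrite mulr_natl -lnXn // ler_ln ?posrE ?exprn_gt0 ?mulr_gt0 ?ltr0n //.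
rewrite -natrX -natrM ler_nat; case: x x0 => [//|[|x]] _; first by rewrite up_log1.
have := @up_log_gtn 2 x.+2 isT isT; case: (up_log 2 x.+2) => [|k] /=; first lia.
by move=> /ltnW h; rewrite expnS leq_mul2l h.
Qed.

Lemma LZ_le_ln (R : realType) (T : finType) (y : seq T) (W W' : seq (seq T)) :
  (0 < #|T|)%N -> (0 < size y)%N -> lz_parse y = W ++ W' -> (size W' <= 1)%N ->
  (LZ y)%:R * ln 2 <= (size W)%:R * ln (size W)%:R
    + (size W)%:R * ln (2 * #|T|%:R)
    + (ln (2 * #|T|%:R) + ln (size y)%:R) :> R.
Proof.
move=> T0 y0 yE sW'; set c := size W; set K := #|T|.
have K0 : 0 < 2 * K%:R :> R by rewrite mulr_gt0 ?ltr0n.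
pose F (j : nat) : R := ln (2 * K%:R) + ln j%:R.
have FE (j : nat) : (0 < j)%N -> (up_log 2 (j * K))%:R * ln 2 <= F j.
  move=> j0; apply: le_trans (up_log2_le _ _) _; first by rewrite muln_gt0 j0.
  by rewrite /F -lnM ?posrE ?ltr0n // natrM mulrA [_ * _ * K%:R]mulrAC.
have Fle (i j : nat) : (0 < i)%N -> (i <= j)%N -> F i <= F j.
  move=> i0 ij; rewrite lerD2l ler_ln ?posrE ?ltr0n // ?ler_nat //.
  exact: leq_trans i0 ij.
have F0 : 0 <= F (size y).
  by rewrite addr_ge0 // ln_ge0 ?ler1n // -natrM ler1n muln_gt0.
apply: (@le_trans _ _ (\sum_(1 <= j < (size (lz_parse y)).+1) F j)).
  rewrite natr_sum mulr_suml big_nat [leRHS]big_nat; apply: ler_sum => j.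
  by move=> /andP[j0 _]; exact: FE.
apply: (@le_trans _ _ (\sum_(1 <= j < c.+1) F j + F (size y))).
  have := size_lz_parse y; rewrite yE size_cat -/c.
  case: (size W') sW' => [|[|//]] _ cy; first by rewrite addn0 lerDl.
  rewrite addn1 big_nat_recr //= lerD2l; apply: Fle => //.
  by rewrite -addn1.
rewrite lerD2r.
apply: (@le_trans _ _ (\sum_(1 <= j < c.+1) F c)).
  rewrite big_nat [leRHS]big_nat; apply: ler_sum => j /andP[j0 jc].
  exact: Fle.
by rewrite sumr_const_nat subn1 /= -[F c *+ c]mulr_natl mulrDr addrC.
Qed.

(** The number of distinct phrases is O(n / log n): apply [uniq_strings_entropy] with letter weights
    [1 / (2K)], so that [s = 1/2] and the total cost is proportional to the total length. *)
Lemma distinct_factors_count (R : realType) (T : finType) (y : seq T)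
    (W W' : seq (seq T)) :
  (0 < #|T|)%N -> (0 < size y)%N -> (size W <= size y)%N ->
  y = flatten (W ++ W') -> uniq W ->
  (size W)%:R * ln ((size y)%:R + 1) <=
    (size y)%:R * (ln (2 * #|T|%:R) + 1 + 2 * ln 2) :> R.
Proof.
move=> T0 y0 Wy yE uW; set c : R := (size W)%:R; set n : R := (size y)%:R.
have cn : c <= n by rewrite ler_nat.
have n1 : 1 <= n by rewrite ler1n.
have n0 : 0 < n by exact: lt_le_trans n1.
have K0 : 0 < 2 * #|T|%:R :> R by rewrite mulr_gt0 ?ltr0n.
have ln2 : 0 <= ln 2 :> R by rewrite ln_ge0 // ler1n.
have lnK : 0 <= ln (2 * #|T|%:R) :> R by rewrite ln_ge0 // -natrM ler1n muln_gt0.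
have [c0|c0] := eqVneq (size W) 0%N.
  rewrite /c c0 mul0r; apply: mulr_ge0; first exact: ltW.
  by rewrite !addr_ge0 // mulr_ge0.
have cpos : 0 < c by rewrite ltr0n lt0n.
pose f (_ : T) : R := (2 * #|T|%:R)^-1.
have f0 a : 0 < f a by rewrite invr_gt0.
have fs : \sum_a f a <= 1 / 2.
  rewrite sumr_const -mulr_natl le_eqVlt; apply/orP; left; apply/eqP.
  by rewrite /f; field; rewrite pnatr_eq0 -lt0n.
have s1 : 1 / 2 < 1 :> R by lra.
have h := uniq_strings_entropy (fun a => ltW (f0 a)) fs s1 uW
  (fun _ _ a _ => f0 a).
have {h}hc : c * ln c <= n * ln (2 * #|T|%:R) + c * ln 2.
  apply: le_trans h _.
  have -> : 1 - 1 / 2 = 2^-1 :> R by field.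
  rewrite [ln 2^-1]lnV ?posrE // mulrN opprK lerD2r.
  rewrite (eq_bigr (fun w => (size w)%:R * ln (2 * #|T|%:R))); last first.
    move=> w _; rewrite /f big_const_seq count_predT iter_addr_0 [RHS]mulr_natl.
    by rewrite lnV ?posrE // opprK.
  rewrite -mulr_suml -natr_sum ler_wpM2r // ler_nat.
  rewrite yE flatten_cat size_cat size_flatten sumnE big_map.
  exact: leq_addr.
have h1 : c * ln n <= c * ln c + (n - c).
  have -> : ln n = ln c + ln (1 + (n / c - 1)).
    by rewrite subrKC -lnM ?posrE ?divr_gt0 // mulrCA mulfV ?mulr1 // gt_eqF.
  rewrite mulrDr lerD2l.
  have : ln (1 + (n / c - 1)) <= n / c - 1.
    by apply: le_ln1Dx; rewrite ltrBrDl subrr divr_gt0.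
  by rewrite -(ler_pM2l cpos) mulrBr mulrCA mulfV ?mulr1 // gt_eqF.
have h2 : ln (n + 1) <= ln n + ln 2.
  rewrite -lnM ?posrE // ler_ln ?posrE ?mulr_gt0 ?addr_gt0 //; lra.
have h3 : c * ln (n + 1) <= c * ln n + c * ln 2 by rewrite -mulrDr ler_wpM2l // ltW.
have h4 : c * ln 2 <= n * ln 2 by rewrite ler_wpM2r.
have -> : n * (ln (2 * #|T|%:R) + 1 + 2 * ln 2) =
  n * ln (2 * #|T|%:R) + n + n * ln 2 + n * ln 2 by ring.
lra.
Qed.

Lemma ln_succ_le (R : realType) (n : nat) : (0 < n)%N ->
  (1 + ln n%:R) * ln (n%:R + 1) <= 9 * n%:R :> R.
Proof.
move=> n0; set x : R := n%:R.
have x1 : 1 <= x by rewrite ler1n.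
have h1 : ln (x + 1) <= x by rewrite addrC le_ln1Dx //; lra.
have h0 : 0 <= ln x by rewrite ln_ge0.
have h2 : ln x <= ln (x + 1) by rewrite ler_ln ?posrE //; lra.
(* [ln r <= r] at this square root gives [ln (x + 1) <= 2 r], so the square of the logarithm is at
   most [4 (x + 1)], itself at most [8 x]. *)
pose r := Num.sqrt (x + 1).
have r0 : 0 < r by rewrite sqrtr_gt0; lra.
have rr : r * r = x + 1 by rewrite -expr2 sqr_sqrtr //; lra.
have h3 : ln (x + 1) <= 2 * r.
  rewrite -rr lnM ?posrE //; have := ln_sublinear r0; lra.
have h4 : ln (x + 1) * ln (x + 1) <= (2 * r) * (2 * r).
  by apply: ler_pM => //; apply: le_trans h2.
have h5 : ln x * ln (x + 1) <= ln (x + 1) * ln (x + 1).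
  by rewrite ler_wpM2r // (le_trans h0).
have : (2 * r) * (2 * r) = 4 * (x + 1) by rewrite -rr; ring.
rewrite mulrDl mul1r; lra.
Qed.

Section Redundancy.
Variables (R : realType).

(** The first product collects the per-phrase overheads, multiplied by the constant from
    [distinct_factors_count]; the second term absorbs the logarithmic remainders by [ln_succ_le]. *)
Definition redundancy_const (K l : nat) : R :=
  (ln (2 * K%:R) + 1 + 2 * ln 2) *
    ((2 * l)%:R * ln (4 * K%:R) + ln 4 + ln (2 * K%:R))
  + 9 * (ln (2 * K%:R) + 1 + (K ^ l)%:R).

Definition redundancy (K n l : nat) : R :=
  l%:R^-1 + redundancy_const K l / (ln 2 * ln (n%:R + 1)).

Lemma sum_block (T : finType) (m l : nat) (y : (m * l).-tuple T)
    (F : l.-tuple T -> R) :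
  \sum_(i < m) F (block y i) = \sum_a (multiplicity y a)%:R * F a.
Proof.
rewrite (partition_big (block y) xpredT) //=; apply: eq_bigr => a _.
rewrite (eq_bigr (fun=> F a)) => [|i /eqP -> //].
by rewrite big_const iter_addr_0 mulr_natl /multiplicity cardsE.
Qed.

Lemma multiplicity_le (T : finType) (m l : nat) (y : (m * l).-tuple T)
    (a : l.-tuple T) :
  (multiplicity y a <= m)%N.
Proof. by rewrite (leq_trans (max_card _)) // card_ord. Qed.

(** Method-of-types estimate: the empirical block entropy of [y] exceeds the log-multinomial
    coefficient by at most a term logarithmic in [m] for each of the [#|T| ^ l] possible blocks. *)
Lemma ln_prod_fact_multiplicity_le (T : finType) (m l : nat)
    (y : (m * l).-tuple T) : (0 < m)%N ->
  \sum_a ln ((multiplicity y a)`!)%:R +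
  \sum_(i < m) - ln ((multiplicity y (block y i))%:R / m%:R) <=
  ln (m`!)%:R + (#|T| ^ l)%:R * (1 + ln m%:R) :> R.
Proof.
move=> m0.
have h1 : \sum_a ln ((multiplicity y a)`!)%:R <=
    \sum_(i < m) ln (multiplicity y (block y i))%:R - m%:R
    + (#|T| ^ l)%:R * (1 + ln m%:R) :> R.
  apply: (@le_trans _ _ (\sum_a ((multiplicity y a)%:R * ln (multiplicity y a)%:R
     - (multiplicity y a)%:R * 1 + (1 + ln m%:R)))).
    apply: ler_sum => a _; apply: le_trans (ln_fact_le _ _) _.
    rewrite mulr1 addrA lerD2l.
    case: (posnP (multiplicity y a)) => [->|ma]; first by rewrite ln0 // ln_ge0 ?ler1n.
    by rewrite ler_ln ?posrE ?ltr0n // ler_nat multiplicity_le.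
  rewrite big_split /= sumrB.
  rewrite -(sum_block y (fun a => ln (multiplicity y a)%:R)).
  rewrite -(sum_block y (fun=> 1)) sumr_const card_ord.
  by rewrite sumr_const card_tuple mulr_natl.
have h2 : \sum_(i < m) - ln ((multiplicity y (block y i))%:R / m%:R) =
    m%:R * ln m%:R - \sum_(i < m) ln (multiplicity y (block y i))%:R :> R.
  have -> : m%:R * ln m%:R = \sum_(i < m) ln m%:R :> R.
    by rewrite sumr_const card_ord mulr_natl.
  rewrite -sumrB; apply: eq_bigr => i _; rewrite ln_div ?opprB // posrE ltr0n //.
  by rewrite card_gt0; apply/set0Pn; exists i; rewrite inE.
have := ln_fact_ge R m; rewrite h2; lra.
Qed.

(** Ziv type inequality in additive form. The leading term [c ln c] of [LZ_le_ln] is bounded by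
    [distinct_factors_entropy]; the overheads are linear in the number of phrases, hence O(n / log
    n). *)
Lemma LZ_block_entropy (T : finType) (m l : nat) (y : (m * l).-tuple T) :
  (0 < #|T|)%N -> (0 < m)%N -> (0 < l)%N ->
  (LZ y)%:R * ln 2 + \sum_a ln ((multiplicity y a)`!)%:R <=
  ln (m`!)%:R + (m * l)%:R * redundancy #|T| (m * l) l * ln 2 :> R.
Proof.
move=> T0 m0 l0; set n := (m * l)%N; set K := #|T|.
have n0 : (0 < n)%N by rewrite muln_gt0 m0.
have [W [W' [yE uW sW']]] := uniq_lz_parse y.
have szy : size y = n by rewrite size_tuple.
have Wn : (size W <= n)%N.
  by rewrite -szy (leq_trans _ (size_lz_parse y)) // yE size_cat leq_addr.
have flE : val y = flatten (W ++ W') by rewrite -yE flatten_lz_parse.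
have h1 := @distinct_factors_entropy R T m l y T0 m0 l0 W W' flE uW.
have h2 := @distinct_factors_count R T y W W' T0; rewrite szy in h2.
have {}h2 := h2 n0 Wn flE uW.
have h3 := @LZ_le_ln R T y W W' T0; rewrite szy in h3.
have {}h3 := h3 n0 yE sW'.
have h4 := ln_prod_fact_multiplicity_le y m0.
have h5 := ln_succ_le R n0.
have lmn : ln m%:R <= ln n%:R :> R.
  by rewrite ler_ln ?posrE ?ltr0n // ler_nat leq_pmulr.
have lnm : 0 <= ln m%:R :> R by rewrite ln_ge0 // ler1n.
have ln2 : 0 < ln 2 :> R by rewrite ln_gt0 // ltr1n.
have lK : 0 <= ln (2 * K%:R) :> R by rewrite ln_ge0 // -natrM ler1n muln_gt0.
have l4K : 0 <= ln (4 * K%:R) :> R by rewrite ln_ge0 // -natrM ler1n muln_gt0.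
have l4 : 0 <= ln 4 :> R by rewrite ln_ge0 // ler1n.
have lnn : 0 < ln (n%:R + 1) :> R by rewrite ln_gt0 // ltrDr ltr0n.
(* The [1/l] part of the redundancy is exactly the one bit per block. *)
have -> : n%:R * redundancy K n l * ln 2 =
    m%:R * ln 2 + n%:R * redundancy_const K l / ln (n%:R + 1) :> R.
  rewrite /redundancy /n natrM; field.
  by rewrite -natrM !gt_eqF // ltr0n.
set A : R := (2 * l)%:R * ln (4 * K%:R) + ln 4 + ln (2 * K%:R).
have A0 : 0 <= A by rewrite !addr_ge0 ?mulr_ge0.
have key : (size W)%:R * A + (ln (2 * K%:R) + ln n%:R) + (K ^ l)%:R * (1 + ln m%:R)
   <= n%:R * redundancy_const K l / ln (n%:R + 1).
  rewrite ler_pdivlMr //.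
  have k1 : (size W)%:R * A * ln (n%:R + 1) <=
      n%:R * ((ln (2 * K%:R) + 1 + 2 * ln 2) * A).
    by rewrite mulrAC mulrA ler_wpM2r.
  have k2 : ln (2 * K%:R) + ln n%:R + (K ^ l)%:R * (1 + ln m%:R) <=
     (ln (2 * K%:R) + 1 + (K ^ l)%:R) * (1 + ln n%:R) :> R.
    rewrite [leRHS]mulrDl lerD //; last by rewrite ler_wpM2l // lerD2l.
    have := mulr_ge0 lK (le_trans lnm lmn).
    rewrite mulrDl mulrDr mul1r mulr1; lra.
  have k3 := ler_wpM2r (ltW lnn) k2.
  have {}h5 : (ln (2 * K%:R) + 1 + (K ^ l)%:R) * (1 + ln n%:R) * ln (n%:R + 1) <=
     (ln (2 * K%:R) + 1 + (K ^ l)%:R) * (9 * n%:R) :> R.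
    by rewrite -mulrA ler_wpM2l // !addr_ge0.
  have -> : n%:R * redundancy_const K l =
    n%:R * ((ln (2 * K%:R) + 1 + 2 * ln 2) * A)
    + (ln (2 * K%:R) + 1 + (K ^ l)%:R) * (9 * n%:R) :> R.
    by rewrite /redundancy_const -/A; ring.
  rewrite -addrA mulrDl; lra.
have cA : (size W)%:R * A =
   (size W)%:R * ((2 * l)%:R * ln (4 * K%:R) + ln 4) + (size W)%:R * ln (2 * K%:R).
  by rewrite /A; ring.
rewrite -/K in h1 h2 h3 h4; lra.
Qed.

Lemma cvg_redundancy (K l : nat) : (0 < l)%N ->
  redundancy K (m * l) l @[m --> \oo] --> (l%:R^-1 : R).
Proof.
move=> l0; rewrite -[X in _ --> X]addr0; apply: cvgD; first exact: cvg_cst.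
under eq_fun do rewrite invfM mulrA.
rewrite -(mulr0 (redundancy_const K l / ln 2)); apply: cvgM; first exact: cvg_cst.
apply/gtr0_cvgV0.
  near=> m; rewrite ln_gt0 // ltrDr ltr0n muln_gt0 l0 andbT.
  by near: m; exact: nbhs_infty_gt.
apply/cvgryPge => A; near=> m.
rewrite -[A]expRK ler_ln ?posrE ?expR_gt0 ?ltr_wpDl //.
apply: (@le_trans _ _ m%:R); last first.
  by rewrite ler_wpDr // ler_nat leq_pmulr.
near: m; move: (expR A); apply/cvgryPge.
exact: cvgr_idn.
Unshelve. all: by end_near.
Qed.

End Redundancy.

                                

(** * Action of block permutations *)

Section BlockPermutation.
Variables (m l : nat).

Lemma divn_block_lt (k : 'I_(m * l)) : (k %/ l < m)%N.
Proof.
have l0 : (0 < l)%N by case: (l) k => // -[k]; rewrite muln0.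
by rewrite ltn_divLR.
Qed.

Lemma modn_block_lt (k : 'I_(m * l)) : (k %% l < l)%N.
Proof. by rewrite ltn_pmod //; case: (l) k => // -[k]; rewrite muln0. Qed.

Definition block_shift (p : {perm 'I_m}) (k : 'I_(m * l)) : 'I_(m * l) :=
  block_index (p (Ordinal (divn_block_lt k))) (Ordinal (modn_block_lt k)).

Lemma block_shift_index (p : {perm 'I_m}) (i : 'I_m) (j : 'I_l) :
  block_shift p (block_index i j) = block_index (p i) j.
Proof.
have l0 : (0 < l)%N by exact: leq_trans (ltn_ord j).
rewrite /block_shift; congr (block_index (p _) _); apply: val_inj => /=.
  by rewrite divnMDl // divn_small ?addn0.
by rewrite modnMDl modn_small.
Qed.

Lemma block_shiftKV (p : {perm 'I_m}) (k : 'I_(m * l)) :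
  block_shift p^-1 (block_shift p k) = k.
Proof.
rewrite {2}/block_shift block_shift_index permK.
by apply: val_inj => /=; rewrite -divn_eq.
Qed.

Lemma block_shift_inj (p : {perm 'I_m}) : injective (block_shift p).
Proof. exact: can_inj (block_shiftKV p). Qed.

Definition permute_blocks (A : Type) (p : {perm 'I_m}) (x : (m * l).-tuple A) :
    (m * l).-tuple A :=
  [tuple tnth x (block_shift p k) | k < m * l].

Lemma block_permute (A : Type) (p : {perm 'I_m}) (x : (m * l).-tuple A)
    (i : 'I_m) :
  block (permute_blocks p x) i = block x (p i).
Proof.
by apply: eq_from_tnth => j; rewrite !tnth_mktuple block_shift_index.
Qed.

Lemma permute_blocksKV (A : Type) (p : {perm 'I_m}) (x : (m * l).-tuple A) :
  permute_blocks p (permute_blocks p^-1 x) = x.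
Proof. by apply: eq_from_tnth => k; rewrite !tnth_mktuple block_shiftKV. Qed.

Lemma emp_dist_permute (R : realType) (X : finType) (p : {perm 'I_m})
    (x : (m * l).-tuple X) :
  emp_dist R l (permute_blocks p x) = emp_dist R l x.
Proof.
apply/ffunP => a; rewrite !ffunE; congr (_ * _).
have [l0|l0] := posnP l.
  have -> : (m * l %/ l = 0)%N by rewrite l0 divn0.
  by rewrite !big_ord0.
rewrite mulnK // [RHS](reindex_inj (@perm_inj _ p)) /=.
by apply: eq_bigr => i _; rewrite -(val_block (permute_blocks p x)) -(val_block x) block_permute.
Qed.

Lemma joint_emp_dist_permute (R : realType) (X Y : finType) (p : {perm 'I_m})
    (x : (m * l).-tuple X) (y : (m * l).-tuple Y) :
  joint_emp_dist R (permute_blocks p x) (permute_blocks p y) =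
  joint_emp_dist R x y.
Proof.
apply/ffunP => -[a b]; rewrite !ffunE /=; congr (_ * _).
rewrite [RHS](reindex_inj (@block_shift_inj p)) /=.
by apply: eq_bigr => k _; rewrite !tnth_mktuple.
Qed.

Lemma card_permute_blocks_le (A : finType) (y z : (m * l).-tuple A) :
  (#|[set p | permute_blocks p y == z]%SET| <= \prod_a (multiplicity y a)`!)%N.
Proof.
apply: leq_trans (card_perm_relabel (block y) (block z)).
apply/subset_leq_card/fintype.subsetP => p; rewrite !inE => /eqP <-.
by apply/forallP => i; rewrite block_permute.
Qed.

End BlockPermutation.

(** * Covering the permuted sequences by codewords *)

Section Covering.
Variables (R : realType) (X Xhat : finType) (m l : nat).
Variable rho : {ffun X * Xhat -> R} -> R.
Variable d : (m * l).-tuple X -> (m * l).-tuple Xhat -> R.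
Hypothesis dE : forall x y, d x y = (m * l)%:R * rho (joint_emp_dist R x y).
Variables (D : R) (c : rd_code X Xhat (m * l)).
Hypothesis cD : semifaithful d D c.
Variable P : {ffun l.-tuple X -> R}.

Lemma card_permute_within_le (x : (m * l).-tuple X) (z : (m * l).-tuple Xhat) :
  (#|[set p : {perm 'I_m} | (d (permute_blocks p x) z <= (m * l)%:R * D)%R]%SET| <=
   \sum_(y in dsphere d D x) \prod_a (multiplicity y a)`!)%N.
Proof.
apply: leq_trans (_ : (\sum_(y in dsphere d D x)
    #|[set p | permute_blocks p y == z]%SET| <= _)%N); last first.
  by apply: leq_sum => y _; exact: card_permute_blocks_le.
under eq_bigr do rewrite -sum1dep_card big_mkcond /=.
rewrite exchange_big -sum1dep_card big_mkcond; apply: leq_sum => p _.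
(* Each admissible [p] is counted at [y = p^-1 z], which lies in the sphere by invariance of [d]. *)
case: ifP => // dz; rewrite (bigD1 (permute_blocks p^-1 z)) /=.
  by rewrite permute_blocksKV eqxx.
rewrite inE; suff -> : d x (permute_blocks p^-1 z) = d (permute_blocks p x) z by [].
by rewrite !dE -(joint_emp_dist_permute R p) permute_blocksKV.
Qed.

                                                                               
                                                                 
(** Count pairs of a permutation [p] and a codeword whose reproduction is within the allowed
    distortion of [p x]: semifaithfulness gives every [p] at least one, and [card_permute_within_le]
    bounds the number of [p] per codeword. *)
Lemma fact_le_covering (x : (m * l).-tuple X) :
  x \in type_class (m * l) P ->
  (m`! <= #|` codewords c (type_class (m * l) P)| *
    \sum_(y in dsphere d D x) \prod_a (multiplicity y a)`!)%N.
Proof.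
rewrite inE => /eqP xP; set W := codewords _ _.
set S := (\sum_(y in _) _)%N.
apply: (@leq_trans (\sum_(w <- W)
    #|[set p : {perm 'I_m} | (d (permute_blocks p x) (dec c w) <= (m * l)%:R * D)%R]%SET|)).
  under eq_bigr do rewrite -sum1dep_card big_mkcond /=.
  rewrite exchange_big /= -card_Sn -sum1_card.
  apply: leq_sum => p _.
  have pW : enc c (permute_blocks p x) \in W.
    apply/imfsetP; exists (permute_blocks p x); rewrite // /= inE.
    by rewrite emp_dist_permute xP.
  by rewrite (big_rem _ pW) /= (cD (permute_blocks p x)) leq_addr.
apply: (@leq_trans (\sum_(w <- W) S)).
  by apply: leq_sum => w _; exact: card_permute_within_le.
by rewrite big_const_seq count_predT iter_addn_0 mulnC.
Qed.

Lemma codewords_Uprob_ge (x : (m * l).-tuple X) :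
  (0 < m)%N -> (0 < l)%N -> x \in type_class (m * l) P ->
  1 <= #|` codewords c (type_class (m * l) P)|%:R *
    (2 `^ ((m * l)%:R * redundancy R #|Xhat| (m * l) l) *
     Uprob R (dsphere d D x)).
Proof.
move=> m0 l0 xT; set M := #|` _|; set n := (m * l)%N; set r := redundancy _ _ _ _.
have K0 : (0 < #|Xhat|)%N.
  by apply/card_gt0P; exists (tnth (dec c [::]) (block_index (Ordinal m0) (Ordinal l0))).
have f0 : 0 < (m`!)%:R :> R by rewrite ltr0n fact_gt0.
have Z1 : \sum_(z : n.-tuple Xhat) 2 ^- LZ z <= 1 :> R by exact: LZ_kraft.
have Z0 : 0 < \sum_(z : n.-tuple Xhat) 2 ^- LZ z :> R.
  rewrite (bigD1 (dec c [::])) //=; apply: ltr_pwDl.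
    by rewrite invr_gt0 exprn_gt0.
  by apply: sumr_ge0 => z _; rewrite invr_ge0 exprn_ge0.
(* Trade the permutation count of [y] for [Udist]: the Ziv type inequality gives [2^-LZ(y)], and
   dividing by the normalizer, at most 1 by Kraft, only increases it. *)
have step (y : n.-tuple Xhat) : (\prod_a (multiplicity y a)`!)%:R <=
    (m`!)%:R * (2 `^ (n%:R * r) * Udist R y) :> R.
  apply: (@le_trans _ _ ((m`!)%:R * (2 `^ (n%:R * r) * 2 ^- LZ y))); last first.
    rewrite ler_pM2l // ler_pM2l ?powR_gt0 // /Udist ler_pdivlMr //.
    by rewrite ler_piMr // invr_ge0 exprn_ge0.
  have prod0 : (0 < \prod_a (multiplicity y a)`!)%N.
    by rewrite prodn_gt0 // => a; exact: fact_gt0.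
  rewrite -ler_ln ?posrE ?ltr0n // ?mulr_gt0 ?powR_gt0 ?invr_gt0 ?exprn_gt0 //.
  rewrite lnM ?posrE ?mulr_gt0 ?powR_gt0 ?invr_gt0 ?exprn_gt0 //.
  rewrite lnM ?posrE ?powR_gt0 ?invr_gt0 ?exprn_gt0 // ln_powR.
  rewrite lnV ?posrE ?exprn_gt0 // lnXn // -[_ *+ LZ y]mulr_natl.
  have := LZ_block_entropy R y K0 m0 l0.
  have -> : \sum_a ln ((multiplicity y a)`!)%:R =
      ln (\prod_a (multiplicity y a)`!)%:R :> R.
    have : forall s : seq (l.-tuple Xhat),
      \sum_(a <- s) ln ((multiplicity y a)`!)%:R =
      ln (\prod_(a <- s) (multiplicity y a)`!)%:R :> R.
      elim=> [|a s IHs]; first by rewrite !big_nil ln1.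
      rewrite !big_cons IHs natrM lnM // posrE ltr0n ?fact_gt0 //.
      by rewrite prodn_gt0 // => b; exact: fact_gt0.
    exact.
  by rewrite -/n -/r; lra.
have := fact_le_covering xT; rewrite -(ler_nat R) natrM natr_sum -/M => h.
have : (m`!)%:R * 1 <= (m`!)%:R * (M%:R * (2 `^ (n%:R * r) * Uprob R (dsphere d D x))).
  rewrite mulr1 mulrCA; apply: le_trans h _; apply: ler_wpM2l => //.
  rewrite /Uprob mulr_sumr mulr_sumr; apply: ler_sum => y _; exact: step.
by rewrite ler_pM2l.
Qed.

End Covering.

(** * Few short codewords, and conclusion *)

(** Compare with the longest string of [B], of length [k]: there are fewer than [2^(k+1)] binary
    strings of length at most [k]. *)
Lemma short_strings_count (R : realType) (B : seq (seq bool)) (t : R) :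
  0 <= t -> uniq B -> {in B, forall w, 2 ^+ size w <= t} -> (size B)%:R <= 2 * t.
Proof.
move=> t0 uB Bt; case: (B =P [::]) => [->|/eqP B0]; first by rewrite mulr_ge0.
have [w wB wmax] : exists2 w, w \in B & {in B, forall v, (size v <= size w)%N}.
  elim: B B0 {uB Bt} => // v B IHB _; have [->|/IHB[w wB wmax]] := eqVneq B [::].
    by exists v; rewrite ?mem_head // => u; rewrite inE => /eqP ->.
  have [vw|wv] := leqP (size v) (size w).
    exists w; first by rewrite inE wB orbT.
    by move=> u; rewrite inE => /orP[/eqP -> //|/wmax].
  exists v; first by rewrite mem_head.
  move=> u; rewrite inE => /orP[/eqP -> //|/wmax] uw.
  exact: leq_trans uw (ltnW wv).
have := @card_strings_le B (size w).+1 uB wmax; rewrite -(ler_nat R) => h.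
by apply: le_trans h _; rewrite natrX exprS ler_pM2l // Bt.
Qed.

Lemma codeword_fraction_ge (R : realType) (X Xhat : finType) (n : nat)
    (c : rd_code X Xhat n) (A : {set n.-tuple X}) (Q : n.-tuple X -> bool) (s : R) :
  A != finset.set0 -> 0 <= s ->
  (forall x, x \in A -> ~~ Q x -> 2 ^+ size (enc c x) <= #|` codewords c A|%:R * s) ->
  1 - 2 * s <= codeword_fraction R c A Q.
Proof.
move=> A0 s0 AQ; rewrite /codeword_fraction; set W := codewords c A.
set good := fun w => [forall x in A, (enc c x == w) ==> Q x].
have W0 : 0 < #|` W|%:R :> R.
  have [x xA] := set0Pn _ A0.
  rewrite ltr0n cardfs_gt0; apply/fset0Pn; exists (enc c x).
  by apply/imfsetP; exists x.
have -> : #|` [fset w in W | good w]%fset| = count good W.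
  rewrite -size_filter; apply: perm_size; apply: uniq_perm.
  - exact: fset_uniq.
  - by rewrite filter_uniq // fset_uniq.
  - by move=> w; rewrite mem_filter !inE andbC.
have cW : (count good W)%:R + (count (predC good) W)%:R = #|` W|%:R :> R.
  by rewrite -natrD count_predC.
suff : (count (predC good) W)%:R <= 2 * (#|` W|%:R * s) :> R.
  by rewrite ler_pdivlMr // => h; lra.
rewrite -size_filter; apply: short_strings_count.
- by rewrite mulr_ge0.
- by rewrite filter_uniq // fset_uniq.
move=> w; rewrite mem_filter => /andP[/=].
by rewrite negb_forall_in => /exists_inP[x xA]; rewrite negb_imply => /andP[/eqP <- /(AQ _ xA)].
Qed.

Theorem theorem1 (R : realType) (J K : nat) :
  exists Delta : nat -> nat -> R,
    (forall l : nat, (0 < l)%N ->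
       Delta (m * l)%N l @[m --> \oo] --> (l%:R^-1 : R)) /\
    forall (X Xhat : finType), #|X| = J -> #|Xhat| = K ->
    forall (rho : {ffun X * Xhat -> R} -> R) (n l : nat),
      (0 < n)%N -> (0 < l)%N -> (l %| n)%N ->
    forall P : {ffun l.-tuple X -> R}, emp_dists n P ->
    forall d : n.-tuple X -> n.-tuple Xhat -> R,
      (forall x y, 0 <= d x y) ->
      (forall x y, d x y = n%:R * rho (joint_emp_dist R x y)) ->
    forall D : R, 0 <= D ->
    forall c : rd_code X Xhat n, one_to_one c -> semifaithful d D c ->
    forall eps : R, 0 < eps ->
      1 - 2 * n%:R `^ (- eps) <=
      codeword_fraction R c (type_class n P) (fun x =>
        - log2 (Uprob R (dsphere d D x)) - n%:R * Delta n l
          - eps * log2 (n%:R : R)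
        <= (size (enc c x))%:R).
Proof.
(* The redundancy depends only on [n], [l] and the reproduction alphabet size. *)
exists (redundancy R K); split=> [l|]; first exact: cvg_redundancy.
move=> X Xhat _ XK rho n l n0 l0 /dvdnP[m nE]; subst n K.
move=> P [x0 _ x0P] d _ dE D _ c _ cD eps _.
have m0 : (0 < m)%N by move: n0; rewrite muln_gt0 => /andP[].
apply: codeword_fraction_ge => [||x xT].
- by apply/set0Pn; exists x0; rewrite inE; apply/eqP.
- exact: powR_ge0.
have := codewords_Uprob_ge dE cD m0 l0 xT.
set M : R := #|` _|%:R; set U := Uprob _ _; set n : R := (m * l)%:R.
set r := redundancy _ _ _ _ => h1; rewrite -ltNge => h2.
have n1 : 0 < n by rewrite ltr0n.
have ln2 : 0 < ln 2 :> R by rewrite ln_gt0 // ltr1n.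
have p0 : 0 < 2 `^ (n * r) :> R by rewrite powR_gt0.
have MU0 : 0 < M * (2 `^ (n * r) * U) by exact: lt_le_trans h1.
have M0 : 0 < M.
  have M0 : 0 <= M by exact: ler0n.
  rewrite lt_neqAle M0 andbT eq_sym; apply/eqP => M00.
  by move: MU0; rewrite M00 mul0r ltxx.
have U0 : 0 < U by move: MU0; rewrite pmulr_rgt0 // pmulr_rgt0.
rewrite -ler_ln ?posrE ?exprn_gt0 ?mulr_gt0 ?powR_gt0 //.
rewrite lnXn // lnM ?posrE ?powR_gt0 // ln_powR -[_ *+ size _]mulr_natl mulNr.
(* Logarithm of the covering bound; with the failure of the length inequality it yields
   [2 ^ size < M n^-eps]. *)
have h3 : 0 <= ln M + (n * r * ln 2 + ln U).
  by rewrite -ln_powR -lnM ?posrE // -lnM ?posrE ?mulr_gt0 // ln_ge0.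
move: h2; rewrite -(ltr_pM2r ln2) /log2.
have -> : (- (ln U / ln 2) - n * r - eps * (ln n / ln 2)) * ln 2 =
    - ln U - n * r * ln 2 - eps * ln n by field; rewrite gt_eqF.
lra.
Qed.
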